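(* For every uncountable separable compact line $K$ and every nonempty metrizable compact space $M$, the Banach spaces $C(K)$ and $C(K)\oplus C(M)$ are isomorphic.
   Context: A separable compact line is a linearly ordered set whose order topology is compact and separable. $C(K)$ is the Banach space of continuous real-valued functions on the compact space $K$ with the supremum norm; isomorphic means there is a bounded linear bijection with bounded inverse. *)

(* Defs.v *)
From HB Require Import structures.
From mathcomp Require Import all_boot all_order all_algebra.
From mathcomp Require Import all_classical all_reals all_analysis.

Set Implicit Arguments.
Unset Strict Implicit.
Unset Printing Implicit Defensive.
Import Order.TTheory GRing.Theory Num.Theory.
Import numFieldNormedType.Exports.
Local Open Scope classical_set_scope.
Local Open Scope ring_scope.

Definition separable_space (T : topologicalType) : Prop :=
  exists2 D : set T, countable D & dense D.

Definition is_metric (R : realType) (T : Type) (dist : T -> T -> R) : Prop :=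
  [/\ forall x y, 0 <= dist x y,
      forall x y, dist x y = 0 <-> x = y,
      forall x y, dist x y = dist y x &
      forall x y z, dist x z <= dist x y + dist y z].

Definition metrizable (R : realType) (T : topologicalType) : Prop :=
  exists2 dist : T -> T -> R, is_metric dist &
    forall x, nbhs x = nbhs_ball_ (fun y e => [set z | dist y z < e]) x.

(* The compactness proof is a parameter of the type because the supremum norm
   is a norm only when continuous functions are bounded.  The alias also keeps
   this norm apart from the compact-open topology that [continuousType]
   already carries. *)
Definition Cspace (R : realType) (K : topologicalType)
  (cK : compact [set: K]) : Type := continuousType K R.

Section Cspace.
Context {R : realType} {K : topologicalType} (cK : compact [set: K]).
Local Notation CK := (Cspace R cK).

HB.instance Definition _ := Choice.on CK.

Lemma Cspace_eqP (f g : CK) : (forall x, f x = g x) -> f = g.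
Proof. by move=> fg; apply/continuousEP. Qed.

Lemma Cspace_add_continuous (f g : CK) : continuous (fun x => f x + g x).
Proof. by move=> x; apply: cvgD; exact: cts_fun. Qed.

Lemma Cspace_opp_continuous (f : CK) : continuous (fun x => - f x).
Proof. by move=> x; apply: cvgN; exact: cts_fun. Qed.

Lemma Cspace_scale_continuous (a : R) (f : CK) : continuous (fun x => a * f x).
Proof. by move=> x; apply: cvgM; [exact: cvg_cst | exact: cts_fun]. Qed.

Lemma Cspace_zero_continuous : continuous (fun _ : K => 0 : R).
Proof. by move=> x; exact: cvg_cst. Qed.

Definition Cspace_zero : CK := mkcts Cspace_zero_continuous.
Definition Cspace_add (f g : CK) : CK := mkcts (@Cspace_add_continuous f g).
Definition Cspace_opp (f : CK) : CK := mkcts (@Cspace_opp_continuous f).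
Definition Cspace_scale (a : R) (f : CK) : CK :=
  mkcts (@Cspace_scale_continuous a f).

Let addA : associative Cspace_add.
Proof. by move=> f g h; apply: Cspace_eqP => x /=; exact: addrA. Qed.
Let addC : commutative Cspace_add.
Proof. by move=> f g; apply: Cspace_eqP => x /=; exact: addrC. Qed.
Let add0 : left_id Cspace_zero Cspace_add.
Proof. by move=> f; apply: Cspace_eqP => x /=; exact: add0r. Qed.
Let addN : left_inverse Cspace_zero Cspace_opp Cspace_add.
Proof. by move=> f; apply: Cspace_eqP => x /=; exact: addNr. Qed.

HB.instance Definition _ := GRing.isZmodule.Build CK addA addC add0 addN.

Let scaleA a b (f : CK) :
  Cspace_scale a (Cspace_scale b f) = Cspace_scale (a * b) f.
Proof. by apply: Cspace_eqP => x /=; exact: mulrA. Qed.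
Let scale1 : left_id 1 Cspace_scale.
Proof. by move=> f; apply: Cspace_eqP => x /=; exact: mul1r. Qed.
Let scaleDr : right_distributive Cspace_scale +%R.
Proof. by move=> a f g; apply: Cspace_eqP => x /=; exact: mulrDr. Qed.
Let scaleDl (f : CK) : {morph Cspace_scale^~ f : a b / a + b}.
Proof. by move=> a b; apply: Cspace_eqP => x /=; exact: mulrDl. Qed.

HB.instance Definition _ :=
  GRing.Zmodule_isLmodule.Build R CK scaleA scale1 scaleDr scaleDl.

Definition supnorm (f : CK) : R := sup (range (fun x => `|f x|)).

Lemma Cspace_bounded (f : CK) : has_ubound (range (fun x => `|f x|)).
Proof.
have cf : compact (range f).
  by apply: continuous_compact cK; apply: continuous_subspaceT => x;
     exact: cts_fun.
have [M [_ fM]] := compact_bounded cf.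
exists (M + 1) => _ [x _ <-].
by apply: (fM (M + 1)); [rewrite ltrDl | exists x].
Qed.

Lemma le_supnorm (f : CK) x : `|f x| <= supnorm f.
Proof. by apply: ub_le_sup; [exact: Cspace_bounded | exists x]. Qed.

Lemma supnorm_ge0 (f : CK) : 0 <= supnorm f.
Proof.
have [e|/set0P [_ [x _ _]]] := eqVneq (range (fun x => `|f x|)) set0.
  by rewrite /supnorm e sup0.
exact: le_trans (normr_ge0 _) (le_supnorm f x).
Qed.

Lemma supnorm_le (f : CK) r :
  0 <= r -> (forall x, `|f x| <= r) -> supnorm f <= r.
Proof.
move=> r0 fr; rewrite /supnorm.
have [->|/set0P ne] := eqVneq (range (fun x => `|f x|)) set0.
  by rewrite sup0.
by apply: ge_sup => // _ [x _ <-].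
Qed.

Let supnormD (f g : CK) : supnorm (f + g) <= supnorm f + supnorm g.
Proof.
apply: supnorm_le => [|x]; first by rewrite addr_ge0 ?supnorm_ge0.
by rewrite (le_trans (ler_normD _ _))// lerD ?le_supnorm.
Qed.

Let supnormZ (a : R) (f : CK) : supnorm (a *: f) = `|a| * supnorm f.
Proof.
have le b g : supnorm (b *: g) <= `|b| * supnorm g.
  apply: supnorm_le => [|x]; first by rewrite mulr_ge0 ?supnorm_ge0.
  by rewrite normrM ler_wpM2l ?le_supnorm.
have [->|a0] := eqVneq a 0.
  apply/eqP; rewrite eq_le le/= normr0 mul0r; exact: supnorm_ge0.
apply/eqP; rewrite eq_le le/= -ler_pdivlMl ?normr_gt0//.
by rewrite -normfV -{1}(scale1r f) -(mulVf a0) -scalerA.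
Qed.

Let supnorm0_eq0 (f : CK) : supnorm f = 0 -> f = 0.
Proof.
move=> f0; apply: Cspace_eqP => x; apply/normr0_eq0/eqP.
by rewrite eq_le normr_ge0 andbT -f0 le_supnorm.
Qed.

HB.instance Definition _ :=
  Lmodule_isNormed.Build R CK supnormD supnormZ supnorm0_eq0.

End Cspace.

Definition bounded_operator (R : realType) (V W : normedModType R)
  (f : V -> W) : Prop := exists c : R, forall v, `|f v| <= c * `|v|.

(* The inverse of a linear bijection is linear, so linearity is only required
   of [f]. *)
Definition isomorphic (R : realType) (V W : normedModType R) : Prop :=
  exists (f : {linear V -> W}) (g : W -> V),
    [/\ cancel f g, cancel g f, bounded_operator f & bounded_operator g].

(* Main.v *)
From HB Require Import structures.
Require Import Defs.
From mathcomp Require Import all_boot all_order all_algebra.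
From mathcomp Require Import all_classical all_reals all_analysis.
From mathcomp Require Import ring lra.
Import numFieldNormedType.Exports.
Local Open Scope classical_set_scope.
Local Open Scope ring_scope.
Import Order.TTheory GRing.Theory Num.Theory.

(** Why the theorem holds.  Let [L] be the one-point compactification of the
    disjoint sum of countably many copies of [M].  Dropping the first copy is a
    homeomorphism between [L] minus that copy and [L], so [C(L)] is isomorphic
    to [C(L) + C(M)].  It is therefore enough that [C(L)] is complemented in
    [C(K)]: one needs bounded linear maps [E : C(L) -> C(K)] and
    [T : C(K) -> C(L)] with [T (E h) = h].  Then
      [f |-> (f + E (tail (T f)) - E (T f), head (T f))]
    is an isomorphism from [C(K)] to [C(K) + C(M)] ([isomorphic_of_averaging]).
    The space [C(L)] is handled as the set of the functions on [nat * M] that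
    satisfy [cvg_to_constant].

    On the side of [L], which is metrizable, Milutin's argument attaches to each
    point [y] a random branch of the binary tree: the branch passes through the
    node [s] with probability [w s y].  Its law depends continuously on [y] and
    has no atoms, and a long initial segment of the branch determines [y] up to
    a small error ([milutin_weight_exists], [sequences_milutin_weight]).

    On the side of [K], separability implies that all but countably many points
    of an uncountable set have uncountably many points of that set on each side.
    So an uncountable set contains an uncountable initial segment and an
    uncountable final segment separated by points [p < q].  Iterating this gives
    a Cantor scheme: a binary tree of nested sets [node s], the sets of each
    level being disjoint and ordered ([cantor_scheme_exists]).  Urysohn
    functions yield a tree of continuous partitions of unity [u s] on [K], where
    [u s] is 1 on [node s].

    Let [rep s] be a point of [L] whose branch may pass through [s], and
    [point s] a point of [node s].  Then [E h] is the limit of the sums of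
    [u s * h (rep s)] over the nodes of level [n], and [T f] is the limit of the
    sums of [w s * f (point s)], both uniform.  For [E] the reason is that [h]
    varies little over the points whose branch passes through a given node.
    For [T] it is that a continuous [f] oscillates by more than [e] only on
    boundedly many sets of each level ([oscillation_bound]), whose total weight
    tends to 0 because the laws have no atoms. *)

(** * Weights on the binary tree *)

(** The nodes of length [n] of the binary tree.  A node is the list of the
    turns that lead to it, the latest turn first, so that [drop k t] is the
    ancestor of [t] that lies [k] generations above [t]. *)
Fixpoint level (n : nat) : seq (seq bool) :=
  if n is m.+1 then map (cons true) (level m) ++ map (cons false) (level m)
  else [:: [::]].

Lemma size_level n s : s \in level n -> size s = n.
Proof.
elim: n s => [|n IH] s /=; first by rewrite inE => /eqP ->.
by rewrite mem_cat => /orP[] /mapP[t /IH st ->] /=; rewrite st.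
Qed.

Lemma level_uniq n : uniq (level n).
Proof.
elim: n => //= n IH; rewrite cat_uniq !map_inj_uniq ?IH /=; last 2 first.
- by move=> s t [].
- by move=> s t [].
rewrite andbT; apply/hasPn => _ /mapP[s _ ->]; apply/mapP => -[t _].
by [].
Qed.

Section TreeWeight.
Context {R : realType}.
Implicit Types (W F G : seq bool -> R) (n k : nat) (s t : seq bool).

(** A probability measure on the branches of the binary tree, given by the mass
    [W s] of the set of branches through each node [s]. *)
Definition tree_weight W :=
  [/\ W [::] = 1, forall s, 0 <= W s &
      forall s, W (true :: s) + W (false :: s) = W s].

(** The weight of a random walk down the tree that turns to [true] at the node
    [s] with probability [p s]. *)
Fixpoint walk_weight (p : seq bool -> R) s : R :=
  if s is b :: s' then walk_weight p s' * (if b then p s' else 1 - p s') else 1.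

(** The mean of [F] over the nodes of level [n], for the masses [W]. *)
Definition tree_avg W F n : R := \sum_(s <- level n) W s * F s.

Lemma walk_weightP (p : seq bool -> R) :
  (forall s, 0 <= p s <= 1) -> tree_weight (walk_weight p).
Proof.
move=> p01; split=> [//|s|s] /=; last by rewrite -mulrDr addrC subrK mulr1.
elim: s => //= b s IH; apply: mulr_ge0 => //.
by case/andP: (p01 s) => p0 p1; case: b => //; rewrite subr_ge0.
Qed.

Lemma sum_levelS G n :
  \sum_(t <- level n.+1) G t =
  \sum_(s <- level n) (G (true :: s) + G (false :: s)).
Proof. by rewrite big_cat !big_map big_split. Qed.

Lemma tree_avgD W F G n :
  tree_avg W (fun s => F s + G s) n = tree_avg W F n + tree_avg W G n.
Proof. by rewrite -big_split; apply: eq_bigr => s _; rewrite mulrDr. Qed.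

Lemma tree_avgZ W a F n :
  tree_avg W (fun s => a * F s) n = a * tree_avg W F n.
Proof. by rewrite mulr_sumr; apply: eq_bigr => s _; rewrite mulrCA. Qed.

Section Fixed.
Context {W} (wW : tree_weight W).

Lemma tree_weight_ge0 s : 0 <= W s. Proof. by case: wW. Qed.

Lemma tree_weight_cons b s : W (b :: s) <= W s.
Proof.
case: wW => _ W0 WS; rewrite -(WS s).
by case: b; rewrite ?lerDl ?lerDr W0.
Qed.

(** The mass of a node is the total mass of its descendants in a later level. *)
Lemma tree_avg_drop F n k :
  tree_avg W (fun t => F (drop k t)) (n + k) = tree_avg W F n.
Proof.
case: wW => _ _ WS; elim: k => [|k IH].
  by rewrite addn0; apply: eq_bigr => s _; rewrite drop0.
rewrite addnS -IH /tree_avg sum_levelS; apply: eq_bigr => s _ /=.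
by rewrite -mulrDl WS.
Qed.

Lemma tree_avg_cst c n : tree_avg W (fun=> c) n = c.
Proof.
have := tree_avg_drop (fun=> c) 0 n; rewrite add0n => ->.
by rewrite /tree_avg big_seq1; case: wW => -> _ _; rewrite mul1r.
Qed.

Lemma le_tree_avg F G n :
  (forall s, size s = n -> W s != 0 -> F s <= G s) ->
  tree_avg W F n <= tree_avg W G n.
Proof.
move=> FG; rewrite /tree_avg big_seq [leRHS]big_seq.
apply: ler_sum => s /size_level sn; have [->|Ws] := eqVneq (W s) 0.
  by rewrite !mul0r.
by rewrite ler_wpM2l ?tree_weight_ge0 ?FG.
Qed.

Lemma norm_tree_avg F n : `|tree_avg W F n| <= tree_avg W (fun s => `|F s|) n.
Proof.
apply: le_trans (ler_norm_sum _ _ _) _; apply: ler_sum => s _.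
by rewrite normrM (ger0_norm (tree_weight_ge0 _)).
Qed.

Lemma norm_tree_avg_le F n c :
  (forall s, size s = n -> W s != 0 -> `|F s| <= c) -> `|tree_avg W F n| <= c.
Proof.
move=> Fc; apply: le_trans (norm_tree_avg _ _) _.
by rewrite -[leRHS](tree_avg_cst c n); exact: le_tree_avg.
Qed.

Lemma tree_avg_dist_cst F n c e :
  (forall s, size s = n -> W s != 0 -> `|F s - c| <= e) ->
  `|tree_avg W F n - c| <= e.
Proof.
move=> Fc; rewrite -[in leLHS](tree_avg_cst c n).
rewrite /tree_avg -sumrB (eq_bigr (fun s => W s * (F s - c))); last first.
  by move=> s _; rewrite mulrBr.
exact: (norm_tree_avg_le (fun s => F s - c)).
Qed.

(** [G s] bounds the variation of [F] between [s] and its descendants. *)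
Lemma tree_avg_dist F G n k :
  (forall t, size t = (n + k)%N -> `|F t - F (drop k t)| <= G (drop k t)) ->
  `|tree_avg W F (n + k) - tree_avg W F n| <= tree_avg W G n.
Proof.
move=> FG; rewrite -(tree_avg_drop F n k) -(tree_avg_drop G n k).
rewrite /tree_avg -sumrB (eq_bigr (fun t => W t * (F t - F (drop k t)))).
  apply: le_trans (norm_tree_avg (fun t => F t - F (drop k t)) _) _.
  by apply: le_tree_avg => t tn _; exact: FG.
by move=> t _; rewrite mulrBr.
Qed.

End Fixed.
End TreeWeight.

(** * Uniform convergence *)

Section UniformConvergence.
Context {R : realType}.

(** Uniform convergence on a bare type. *)
Definition unif_cvg {X : Type} (g : nat -> X -> R) (l : X -> R) :=
  forall e : R, 0 < e -> exists n0, forall n, (n0 <= n)%N -> forall x,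
    `|g n x - l x| <= e.

Lemma eps_eq {a b : R} : (forall e : R, 0 < e -> `|a - b| <= e) -> a = b.
Proof.
move=> ab; apply/subr0_eq/normr0_eq0/eqP; rewrite eq_le normr_ge0 andbT.
by apply/ler_addgt0Pr => e e0; rewrite add0r ab.
Qed.

Lemma dist_split {a b c e : R} :
  `|a - c| <= e / 2 -> `|c - b| <= e / 2 -> `|a - b| <= e.
Proof.
move=> ac cb; rewrite (splitr e).
by apply: le_trans (ler_distD c _ _) (lerD ac cb).
Qed.

Context {X : Type}.
Context {g h : nat -> X -> R} {l m : X -> R}.

Lemma unif_cvg_uniq : unif_cvg g l -> unif_cvg g m -> l =1 m.
Proof.
move=> gl gm x; apply: eps_eq => e e0.
have e20 : 0 < e / 2 by rewrite divr_gt0.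
have [n nP] := gl _ e20; have [n' nP'] := gm _ e20.
apply: (@dist_split _ _ (g (maxn n n') x)).
  by rewrite distrC nP // leq_maxl.
by rewrite nP' // leq_maxr.
Qed.

Lemma unif_cvg_ext : (forall n, g n =1 h n) -> unif_cvg g l -> unif_cvg h l.
Proof.
move=> gh gl e e0; have [n nP] := gl e e0; exists n => k nk x.
by rewrite -gh nP.
Qed.

Lemma unif_cvgD :
  unif_cvg g l -> unif_cvg h m ->
  unif_cvg (fun n x => g n x + h n x) (fun x => l x + m x).
Proof.
move=> gl hm e e0; have e20 : 0 < e / 2 by rewrite divr_gt0.
have [n nP] := gl _ e20; have [n' nP'] := hm _ e20.
exists (maxn n n') => k; rewrite geq_max => /andP[nk nk'] x.
by rewrite opprD addrACA (splitr e) (le_trans (ler_normD _ _)) // lerD ?nP ?nP'.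
Qed.

Lemma unif_cvgZ a :
  unif_cvg g l -> unif_cvg (fun n x => a * g n x) (fun x => a * l x).
Proof.
move=> gl e e0; have a1 : 0 < `|a| + 1 by rewrite ltr_wpDl.
have [n nP] := gl (e / (`|a| + 1)) (divr_gt0 e0 a1); exists n => k nk x.
rewrite -mulrBr normrM (le_trans (ler_wpM2l (normr_ge0 a) (nP k nk x))) //.
rewrite mulrC -mulrA ler_piMr ?(ltW e0) //.
by rewrite mulrC ler_pdivrMr // mul1r lerDl.
Qed.

Lemma unif_cvg_bound c :
  (forall n x, `|g n x| <= c) -> unif_cvg g l -> forall x, `|l x| <= c.
Proof.
move=> gc gl x; apply/ler_addgt0Pr => e e0.
have [n nP] := gl e e0; rewrite -[l x](subrK (g n x)) addrC.
by rewrite (le_trans (ler_normD _ _)) // lerD ?gc // distrC nP.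
Qed.

Lemma unif_cauchy_cvg :
  (forall e : R, 0 < e -> exists n, forall k x, `|g (n + k)%N x - g n x| <= e) ->
  exists l, unif_cvg g l.
Proof.
move=> cg.
have cx x : cvgn (fun n => g n x).
  apply/cauchy_cvgP/cauchyP => e e0.
  have [n nP] := cg (e / 2) (divr_gt0 e0 (ltr0Sn _ 1)).
  exists (g n x); exists n => // k /= nk; rewrite -ball_normE /= distrC.
  rewrite -(subnKC nk) (le_lt_trans (nP _ _)) //.
  by rewrite ltr_pdivrMr // ltr_pMr // ltr1n.
exists (fun x => limn (fun n => g n x)) => e e0.
have [n nP] := cg (e / 2) (divr_gt0 e0 (ltr0Sn _ 1)); exists n => k nk x.
have gk j : (n <= j)%N -> `|g k x - g j x| <= e.
  move=> nj; apply: (@dist_split _ _ (g n x)).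
    by rewrite -(subnKC nk) nP.
  by rewrite distrC -(subnKC nj) nP.
have cv : (fun j => `|g k x - g j x|) @ \oo -->
    `|g k x - limn (fun j => g j x)|.
  by apply: cvg_norm; apply: cvgB; [exact: cvg_cst|exact: cx].
rewrite -(cvg_lim _ cv) //; apply: limr_le; first by apply/cvg_ex; eexists; exact: cv.
by exists n => // j /= nj; exact: gk.
Qed.

End UniformConvergence.

(** * Two facts on topological spaces *)

Lemma compact_finite_cover (T : topologicalType) (cT : compact [set: T])
    (U : T -> set T) : (forall x, nbhs x (U x)) ->
  exists s : seq T, forall y, exists2 x, x \in s & U x y.
Proof.
move=> Ux; have [[x0 _]|T0] := pselect ([set: T] !=set0); last first.
  by exists [::] => y; case: T0; exists y.
(* [compact_cover] is about pointed types. *)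
pose pT : ptopologicalType := HB.pack T (isPointed.Build T x0).
have : cover_compact [set: pT] by rewrite -compact_cover; exact: cT.
move=> /(_ T setT (fun x => (U x)°)) [x _|x _|s _ sU].
- exact: open_interior.
- by exists x => //; exact: Ux.
exists (finmap.enum_fset s) => y; have [x xs Uxy] := sU y I.
by exists x => //; exact: interior_subset Uxy.
Qed.

Lemma unif_cvg_continuous (R : realType) (T : topologicalType)
    (g : nat -> T -> R) (l : T -> R) :
  (forall n, continuous (g n)) -> unif_cvg g l -> continuous l.
Proof.
move=> cg gl x; apply/cvgrPdist_le => e e0.
have [n nP] := gl (e / 2 / 2) (divr_gt0 (divr_gt0 e0 (ltr0Sn _ 1)) (ltr0Sn _ 1)).
have e20 : 0 < e / 2 by rewrite divr_gt0.
have /cvgrPdist_le/(_ (e / 2 / 2) (divr_gt0 e20 (ltr0Sn _ 1))) := cg n x.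
apply: filterS => y gxy.
apply: (@dist_split _ _ _ (g n x)).
  rewrite distrC (le_trans (nP n _ x)) // ler_pdivrMr // ler_pMr //.
  by rewrite ler1n.
by apply: (@dist_split _ _ _ (g n y)) => //; exact: nP.
Qed.

(** * A Cantor scheme in an uncountable separable compact line *)

Lemma countable_setU (T : Type) (A B : set T) :
  countable A -> countable B -> countable (A `|` B).
Proof.
move=> cA cB; rewrite -bigcup2E; apply: bigcup_countable => //.
by move=> [|[|n]] _ //=; exact: countable0.
Qed.

(** All but countably many points of [A] have uncountably many predecessors in
    [A].  The order is given as a relation so that the statement also applies to
    the reverse order. *)
Lemma countable_small_segments (T : Type) (r : T -> T -> Prop) (D A : set T) :
    (forall x y z, r x y -> r y z -> r x z) -> (forall x y, r x y \/ r y x) ->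
    (forall x y z, r x y -> r y z -> x <> y -> y <> z ->
       exists2 t, D t & r x t /\ r t z) ->
    countable D ->
  countable [set x | A x /\ countable [set y | A y /\ r y x]].
Proof.
move=> rtr rtot rD cD; set L := [set x | countable [set y | A y /\ r y x]].
pose L' := [set x | [/\ A x, L x & forall t, D t -> L t -> ~ r x t]].
(* [L'] holds the points of [A] and [L] that no point of [D] in [L] follows. *)
have LD : [set x | A x /\ L x] `<=`
    \bigcup_(t in D `&` L) [set y | A y /\ r y t] `|` L'.
  move=> x [Ax Lx]; have [[t [Dt Lt xt]]|nt] :=
      pselect (exists t, [/\ D t, L t & r x t]).
    by left; exists t.
  by right; split => // t Dt Lt xt; apply: nt; exists t.
apply: (sub_countable (subset_card_le LD)).
suff cL' : countable L'.
  apply: countable_setU => //; apply: bigcup_countable.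
    exact: (sub_countable (subset_card_le (@subIsetl _ D L))).
  by move=> t [_ Lt].
have [[x [Ax Lx xD]]|L0] := pselect (L' !=set0); last first.
  have -> : L' = set0 by rewrite -subset0 => z L'z; apply: L0; exists z.
  exact: countable0.
(* No point [z] of [L'] lies beyond [y]: a point of [D] between [x] and [z]
   would be in [L].  If there is no such [y], no point of [L'] lies beyond [x]. *)
have [[y [[Ay Ly yD] xy nxy]]|nY] :=
    pselect (exists y, [/\ L' y, r x y & x <> y]).
  apply: (sub_countable _ Ly); apply: subset_card_le => z [Az Lz zD]; split=> //.
  have [//|yz] := rtot z y.
  have [<-|nyz] := pselect (y = z); first by have [] := rtot y y.
  have [t Dt [xt tz]] := rD x y z xy yz nxy nyz.
  case: (xD t Dt _ xt); apply: (sub_countable _ Lz); apply: subset_card_le.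
  by move=> u [Au ut]; split => //; exact: rtr ut tz.
apply: (sub_countable _ Lx); apply: subset_card_le => z [Az Lz zD]; split=> //.
have [//|xz] := rtot z x.
have [<-|nxz] := pselect (x = z); first by have [] := rtot x x.
by case: nY; exists z; split.
Qed.

Lemma uncountable_pair {T : Type} {A : set T} :
  ~ countable A -> exists x y, [/\ A x, A y & x <> y].
Proof.
move=> cA; apply: contrapT => nxy; apply: cA.
have [[x Ax]|A0] := pselect (A !=set0); last first.
  have -> : A = set0 by rewrite -subset0 => z Az; apply: A0; exists z.
  exact: countable0.
apply: (sub_countable _ (countable1 x)); apply: subset_card_le => y Ay.
by apply: contrapT => yx; apply: nxy; exists y, x.
Qed.

Section CompactLine.
Context {R : realType} {d : Order.disp_t} {K : orderTopologicalType d}.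

(** Any two of the points of [A] that have uncountably many points of [A] on
    both sides will do. *)
Lemma uncountable_split (A : set K) :
  separable_space K -> ~ countable A -> exists p q, [/\ (p < q)%O,
    ~ countable (A `&` [set x | (x <= p)%O]) &
    ~ countable (A `&` [set x | (q <= x)%O])].
Proof.
move=> [D cD dD] cA.
have Dlt (x z : K) : (exists y, x < y < z)%O -> exists2 t, D t & (x < t < z)%O.
  move=> [y yxz].
  have [|t [tI Dt]] := dD `]x, z[%classic _ (itv_open _ _).
    by exists y; rewrite /= in_itv.
  by exists t => //; move: tI; rewrite /= in_itv.
have cL := countable_small_segments _ (fun x y : K => (x <= y)%O) D A.
have cU := countable_small_segments _ (fun x y : K => (y <= x)%O) D A.
set S := [set x | A x /\ countable [set y | A y /\ (y <= x)%O]] `|`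
  [set x | A x /\ countable [set y | A y /\ (x <= y)%O]].
have SA : S `<=` A by move=> x [] [].
have /uncountable_pair : ~ countable (A `\` S).
  move=> cA'; apply: cA; rewrite -(setDUK SA).
  apply: countable_setU => //; apply: countable_setU.
  - apply: cL => // [x y z|x y|x y z xy yz /eqP nxy /eqP nyz].
    + exact: le_trans.
    + by apply/orP/le_total.
    + have [|t Dt /andP[xt tz]] := Dlt x z.
        by exists y; rewrite !lt_neqAle nxy xy nyz.
      by exists t => //; split; exact: ltW.
  - apply: cU => // [x y z yx zy|x y|x y z xy yz /eqP nxy /eqP nyz].
    + exact: le_trans yx.
    + by apply/orP/le_total.
    + have [|t Dt /andP[xt tz]] := Dlt z x.
        by exists y; rewrite !lt_def xy yz nyz nxy.
      by exists t => //; split; exact: ltW.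
have main (p q : K) : (p < q)%O ->
    (A `\` S) p -> (A `\` S) q ->
    exists p q, [/\ (p < q)%O, ~ countable (A `&` [set x | (x <= p)%O]) &
      ~ countable (A `&` [set x | (q <= x)%O])].
  move=> pq [Ap np] [Aq nq]; exists p, q; split=> //.
  - by move=> cp; apply: np; left; split.
  - by move=> cq; apply: nq; right; split.
move=> [p [q [Xp Xq /eqP]]]; rewrite neq_lt => /orP[pq|qp].
  exact: main pq Xp Xq.
exact: main qp Xq Xp.
Qed.

Lemma line_separation {p q : K} : compact [set: K] -> (p < q)%O ->
  exists v : K -> R, [/\ continuous v, forall x, 0 <= v x <= 1,
    forall x, (x <= p)%O -> v x = 1 & forall x, (q <= x)%O -> v x = 0].
Proof.
move=> cK pq.
have nK : normal_space K by apply: compact_normal cK; exact: order_hausdorff.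
have qp0 : `[q, +oo[%classic `&` `]-oo, p]%classic = set0.
  rewrite -subset0 => x [/=]; rewrite !in_itv /= andbT => qx xp.
  by move: (le_trans qx xp); rewrite leNgt pq.
have [v [cv v0 v1 v01]] :=
  urysohn_ext_itv nK (@rray_closed _ _ q) (@lray_closed _ _ p) qp0 (@ltr01 R).
exists v; split=> // x.
- have : range v (v x) by exists x.
  by move=> /v01; rewrite /= in_itv.
- by move=> xp; apply: (v1 (v x)); exists x => //=; rewrite in_itv.
- by move=> qx; apply: (v0 (v x)); exists x => //=; rewrite in_itv /= andbT.
Qed.

(** Nested nonempty sets [node s], one for each node of the binary tree, such
    that the [true] child of each lies below the [false] child, together with
    continuous functions [v s] with values in [0, 1] that are 1 on the [true]
    child of [s] and 0 on the [false] child. *)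
Record cantor_scheme (node : seq bool -> set K) (v : seq bool -> K -> R) := {
  node_neq0 : forall s, node s !=set0 ;
  node_cons : forall b s, node (b :: s) `<=` node s ;
  node_lt : forall s x y, node (true :: s) x -> node (false :: s) y -> (x < y)%O ;
  turn_continuous : forall s, continuous (v s) ;
  turn_ge0_le1 : forall x s, 0 <= v s x <= 1 ;
  turn_node : forall b s x, node (b :: s) x -> v s x = b%:R
}.

Lemma cantor_scheme_exists : compact [set: K] -> separable_space K ->
  ~ countable [set: K] -> exists node v, cantor_scheme node v.
Proof.
move=> cK sK uK.
have [x0 [_ _]] := uncountable_pair uK.
have /choice[w wP] : forall A : set K, exists w : K * K * (K -> R),
    ~ countable A -> [/\ (w.1.1 < w.1.2)%O,
      ~ countable (A `&` [set x | (x <= w.1.1)%O]) &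
      ~ countable (A `&` [set x | (w.1.2 <= x)%O])] /\
    [/\ continuous w.2, forall x, 0 <= w.2 x <= 1,
      forall x, (x <= w.1.1)%O -> w.2 x = 1 &
      forall x, (w.1.2 <= x)%O -> w.2 x = 0].
  move=> A; have [cA|/(uncountable_split _ sK)[p [q [pq Ap Aq]]]] :=
      pselect (countable A).
    by exists (x0, x0, fun=> 0).
  by have [v vP] := line_separation cK pq; exists (p, q, v).
pose node := fix node (s : seq bool) : set K := if s is b :: s' then
    node s' `&` (if b then [set x | (x <= (w (node s')).1.1)%O]
                 else [set x | ((w (node s')).1.2 <= x)%O])
  else setT.
have unode s : ~ countable (node s).
  elim: s => //= b s IH; have [[_ Ap Aq] _] := wP _ IH.
  by case: b.
exists node, (fun s => (w (node s)).2); split.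
- by move=> s; have [x [_ [? _ _]]] := uncountable_pair (unode s); exists x.
- by move=> b s x [].
- move=> s x y [_ /= xp] [_ /= qy]; have [[pq _ _] _] := wP _ (unode s).
  exact: le_lt_trans xp (lt_le_trans pq qy).
- by move=> s; have [_ []] := wP _ (unode s).
- by move=> x s; have [_ []] := wP _ (unode s).
- by move=> [] s x [_ /= xs]; have [_ [_ _ v1 v0]] := wP _ (unode s);
    [rewrite v1|rewrite v0].
Qed.

End CompactLine.
Arguments node_cons {R d K node v} _ {b s} [t] _.
Arguments node_lt {R d K node v} _ {s x y} _ _.
Arguments turn_ge0_le1 {R d K node v} _ x s.
Arguments turn_node {R d K node v} _ {b s x} _.

(** * Oscillation along a Cantor scheme *)

Section Oscillation.
Context {R : realType} {d : Order.disp_t} {K : orderTopologicalType d}.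
Context {node : seq bool -> set K} {v : seq bool -> K -> R}.
Hypothesis sch : cantor_scheme node v.

Lemma node_drop k s x : node s x -> node (drop k s) x.
Proof.
elim: k s => [|k IH] [|b s] //= ns; apply: IH; exact (node_cons sch ns).
Qed.

Lemma node_ordered s r : size s = size r -> s != r ->
  (forall x y, node s x -> node r y -> (x < y)%O) \/
  (forall x y, node s x -> node r y -> (y < x)%O).
Proof.
elim: s r => [|b s IH] [|c r] //= [sr]; have [<-{r sr}|nsr _] := eqVneq s r.
  rewrite eqseq_cons eqxx andbT; move: b c => [] [] // _; [left|right].
  - by move=> x y nx ny; exact (node_lt sch nx ny).
  - by move=> x y nx ny; exact (node_lt sch ny nx).
have [H|H] := IH r sr nsr; [left|right] => x y /(node_cons sch) nx
    /(node_cons sch) ny; exact: H.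
Qed.

(** The weights [walk_weight (v ^~ x)] are the partitions of unity on [K]: on
    [node s], the whole mass of the level of [s] is at [s]. *)
Lemma walk_weight_node s r x : node s x -> size r = size s -> r != s ->
  walk_weight (fun s => v s x) r = 0.
Proof.
elim: s r => [|b s IH] [|c r] //= ns [rs]; have [->|nrs _] := eqVneq r s.
  rewrite eqseq_cons eqxx andbT (turn_node sch ns).
  by move: b c {ns} => [] [] //= _; rewrite ?subrr mulr0.
by rewrite (IH r (node_cons sch ns)) // mul0r.
Qed.

Lemma tree_avg_node F s x : node s x ->
  tree_avg (walk_weight (fun s => v s x)) F (size s) = F s.
Proof.
move=> ns; apply: eps_eq => e e0; apply: tree_avg_dist_cst.
  apply: walk_weightP; exact (turn_ge0_le1 sch x).
move=> r rs; have [->|nrs] := eqVneq r s; first by rewrite subrr normr0 ltW.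
by rewrite (walk_weight_node _ _ _ ns rs nrs) eqxx.
Qed.

(** The function [f] varies by more than [e] on the set [node s]. *)
Definition oscillates (f : K -> R) (e : R) (s : seq bool) : bool :=
  `[< exists x y, [/\ node s x, node s y & e < `|f x - f y|] >].

(** At most one node of the level satisfies [Q]. *)
Lemma sum_subsingleton (W : seq bool -> R) (Q : pred (seq bool)) n (c : R) : 0 <= c ->
    (forall s, size s = n -> W s <= c) ->
    (forall s r, size s = size r -> Q s -> Q r -> s = r) ->
  \sum_(s <- level n | Q s) W s <= c.
Proof.
move=> c0 Wc Q1; rewrite -big_filter.
have sF s : s \in [seq s <- level n | Q s] -> size s = n /\ Q s.
  by rewrite mem_filter => /andP[Qs /size_level].
have := filter_uniq Q (level_uniq n).
case: [seq s <- level n | Q s] sF => [|s [|r l]] sF.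
- by rewrite big_nil.
- by rewrite big_seq1 => _; apply: Wc; have [] := sF s (mem_head _ _).
have [ss Qs] := sF s (mem_head _ _).
have [|rs Qr] := sF r; first by rewrite !inE eqxx orbT.
by rewrite /= inE (Q1 s r) ?eqxx // ss rs.
Qed.

(** A continuous function oscillates only along boundedly many nodes of each
    level: among finitely many convex open sets that cover [K] and on which it
    varies little, there is one that such a node meets without being contained
    in it, and at each end of a convex set this can happen only once. *)
Lemma oscillation_bound (f : K -> R) (e : R) :
    compact [set: K] -> continuous f -> 0 < e ->
  exists N : nat, forall (W : seq bool -> R) n c, tree_weight W ->
    (forall s, size s = n -> W s <= c) ->
    tree_avg W (fun s => (oscillates f e s)%:R) n <= N%:R * c.
Proof.
move=> cK cf e0.
pose P (x : K) (V : set K) := [/\ nbhs x V,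
    forall y z, V y -> V z -> `|f y - f z| <= e &
    forall y z t, V y -> V z -> (y <= t <= z)%O -> V t].
have [U UP] : {U : K -> set K & forall x, P x (U x)}.
  apply: choice.
  move=> x; have /cvgrPdist_le/(_ (e / 2)) := cf x.
  rewrite divr_gt0 // => /(_ isT) /=.
  rewrite near_simpl -[X in X -> _]/(nbhs x [set t | `|f x - f t| <= e / 2]).
  rewrite itv_nbhsE => -[i [io xi] iP]; exists [set` i]; split.
  - by rewrite itv_nbhsE; exists i.
  - move=> y z /iP yP /iP zP; apply: (@dist_split _ _ _ (f x)) => //.
    by rewrite distrC.
  - move=> y z t yi zi /andP[yt tz].
    move: i yi zi {io xi iP} => [l u]; rewrite /= !itv_boundlr.
    move=> /andP[ly _] /andP[_ zu]; apply/andP; split.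
      by apply: le_trans ly _; rewrite leBSide.
    by apply: le_trans _ zu; rewrite leBSide.
have [D DP] := compact_finite_cover _ cK U (fun x => let: And3 h _ _ := UP x in h).
(* [node s] meets [U x] and has a point above [U x]. *)
pose above x s := `[< exists a b, [/\ node s a, node s b, U x a &
  forall c, U x c -> (c < b)%O] >].
pose below x s := `[< exists a b, [/\ node s a, node s b, U x a &
  forall c, U x c -> (b < c)%O] >].
exists (size D * 2)%N => W n c wW Wc.
have c0 : 0 <= c.
  by apply: le_trans (Wc (nseq n true) (size_nseq _ _)); exact: tree_weight_ge0.
have above1 x s r : size s = size r -> above x s -> above x r -> s = r.
  move=> sr /asboolP[a [b [sa sb Ua Ub]]] /asboolP[a' [b' [ra rb Ua' Ub']]].
  apply/eqP; apply: contrapT => /negP nsr.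
  have [H|H] := node_ordered _ _ sr nsr.
  - by have := lt_trans (Ub _ Ua') (H _ _ sb ra); rewrite ltxx.
  - by have := lt_trans (Ub' _ Ua) (H _ _ sa rb); rewrite ltxx.
have below1 x s r : size s = size r -> below x s -> below x r -> s = r.
  move=> sr /asboolP[a [b [sa sb Ua Ub]]] /asboolP[a' [b' [ra rb Ua' Ub']]].
  apply/eqP; apply: contrapT => /negP nsr.
  have [H|H] := node_ordered _ _ sr nsr.
  - by have := lt_trans (H _ _ sa rb) (Ub' _ Ua); rewrite ltxx.
  - by have := lt_trans (H _ _ sb ra) (Ub _ Ua'); rewrite ltxx.
(* Let [a] and [b] in [node s] be such that [f] differs by more than [e] between
   them.  If [U x] contains [a], it does not contain [b]; being convex, it lies
   entirely above [b] or entirely below [b]. *)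
have osc s : (oscillates f e s)%:R <=
    \sum_(x <- D) ((above x s)%:R + (below x s)%:R) :> R.
  have [/asboolP[a [b [sa sb ab]]]|_] := boolP (oscillates f e s); last first.
    by apply: sumr_ge0 => x _; rewrite addr_ge0.
  have [x xD Ua] := DP a.
  suff ab1 : 1 <= (above x s)%:R + (below x s)%:R :> R.
    rewrite (big_rem x) // ler_wpDr //.
    by apply: sumr_ge0 => y _; rewrite addr_ge0.
  have [_ Uf Uc] := UP x.
  have nUb : ~ U x b by move=> Ub; have := Uf _ _ Ua Ub; rewrite leNgt ab.
  have [_|nabove] := boolP (above x s); first by rewrite lerDl.
  suff -> : below x s by rewrite lerDr.
  apply/asboolP; exists a, b; split => // c' Uc'.
  have [//|bc|bc] := ltgtP b c'; last by case: nUb; rewrite bc.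
  case/negP: nabove; apply/asboolP; exists a, b; split=> // c2 Uc2.
  have [bc2|//|bc2] := ltgtP b c2; last by case: nUb; rewrite bc2.
  by case: nUb; apply: (Uc c' c2) => //; rewrite (ltW bc) ltW.
apply: (@le_trans _ _
    (tree_avg W (fun s => \sum_(x <- D) ((above x s)%:R + (below x s)%:R)) n)).
  by apply: le_tree_avg.
rewrite /tree_avg; under eq_bigr do rewrite mulr_sumr.
have pick (Q : pred (seq bool)) :
    \sum_(s <- level n) W s * (Q s)%:R = \sum_(s <- level n | Q s) W s.
  rewrite [RHS]big_mkcond; apply: eq_bigr => s _.
  by case: (Q s); rewrite ?mulr1 ?mulr0.
have -> : (size D * 2)%:R * c = \sum_(x <- D) (c + c).
  rewrite big_const_seq count_predT iter_addr_0 -mulr2n -mulrnA mulr_natl.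
  by rewrite mulnC.
rewrite exchange_big; apply: ler_sum => x _.
under eq_bigr do rewrite mulrDr.
rewrite big_split !pick; apply: lerD.
  exact: (sum_subsingleton _ (above x) _ _ c0 Wc (above1 x)).
exact: (sum_subsingleton _ (below x) _ _ c0 Wc (below1 x)).
Qed.

End Oscillation.

(** * Averaging operators *)

Lemma tree_weight_drop {R : realType} {W : seq bool -> R} k s :
  tree_weight W -> W s != 0 -> W (drop k s) != 0.
Proof.
move=> wW; elim: k s => [|k IH] [|b s] //= Ws; apply: IH.
rewrite gt_eqF // (lt_le_trans _ (tree_weight_cons wW b s)) //.
by rewrite lt_def Ws tree_weight_ge0.
Qed.

Lemma continuous_sum (R : realType) (T : topologicalType) (I : Type)
    (r : seq I) (F : I -> T -> R) :
  (forall i, continuous (F i)) -> continuous (fun x => \sum_(i <- r) F i x).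
Proof.
move=> cF; elim: r => [|i r IH].
  by under eq_fun do rewrite big_nil; move=> x; exact: cvg_cst.
under eq_fun do rewrite big_cons.
by move=> x; apply: cvgD; [exact: cF|exact: IH].
Qed.

(** A linear space of real functions that is closed for uniform convergence. *)
Record function_space (R : realType) (Y : Type) (Z : (Y -> R) -> Prop) := {
  fspace0 : Z (fun=> 0) ;
  fspaceD : forall g h, Z g -> Z h -> Z (fun y => g y + h y) ;
  fspaceZ : forall a h, Z h -> Z (fun y => a * h y) ;
  fspace_lim : forall (g : nat -> Y -> R) l,
    (forall n, Z (g n)) -> unif_cvg g l -> Z l
}.

(** A nonatomic random branch of the binary tree for each point of [Y], whose
    law depends on the point through functions of [Z], and such that knowing a
    long initial segment of the branch determines each function of [Z] up to a
    small error. *)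
Record milutin_weight (R : realType) (Y : Type) (Z : (Y -> R) -> Prop)
    (w : seq bool -> Y -> R) := {
  mw_weight : forall y, tree_weight (w ^~ y) ;
  mw_space : forall s, Z (w s) ;
  mw_small : forall e : R, 0 < e ->
    exists n, forall s y, size s = n -> w s y <= e ;
  mw_control : forall h, Z h -> forall e : R, 0 < e ->
    exists n, forall s, size s = n -> forall y y',
      w s y != 0 -> w s y' != 0 -> `|h y - h y'| <= e
}.

Arguments fspace0 {R Y Z}.
Arguments fspaceD {R Y Z} _ {g h}.
Arguments fspaceZ {R Y Z} _ a {h}.
Arguments fspace_lim {R Y Z} _ {g l}.
Arguments mw_weight {R Y Z w}.
Arguments mw_space {R Y Z w}.
Arguments mw_small {R Y Z w} _ [e].
Arguments mw_control {R Y Z w} _ [h] _ [e].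

Section Averaging.
Context {R : realType} {d : Order.disp_t} {K : orderTopologicalType d}.
Context (cK : compact [set: K]).
Context {node : seq bool -> set K} {v : seq bool -> K -> R}.
Hypothesis sch : cantor_scheme node v.
Context {Y : choiceType} (y0 : Y) {Z : (Y -> R) -> Prop}.
Hypothesis sZ : function_space R Y Z.
Context {w : seq bool -> Y -> R}.
Hypothesis mw : milutin_weight R Y Z w.
Local Notation CK := (Cspace R cK).

Let u (x : K) : seq bool -> R := walk_weight (fun s => v s x).

Let uW x : tree_weight (u x).
Proof. by apply: walk_weightP; exact (turn_ge0_le1 sch x). Qed.

Let wW y : tree_weight (w ^~ y). Proof. exact (mw_weight mw y). Qed.

(** A point of [Y] whose random branch passes through [s] with positive
    probability; when there is none, the point chosen for the parent of [s]. *)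
Fixpoint rep (s : seq bool) : Y :=
  if s is b :: s' then xget (rep s') [set y | w s y != 0] else y0.

Lemma rep_neq0 s y : w s y != 0 -> w s (rep s) != 0.
Proof.
case: s => [|b s] wy; first by case: (wW y0) => /= -> _ _; exact: oner_neq0.
by apply: (@xgetPex _ (rep s) [set y | w (b :: s) y != 0]); exists y.
Qed.

Lemma rep_drop k t : w (drop k t) (rep t) != 0 \/ rep t = rep (drop k t).
Proof.
elim: k t => [|k IH] [|b t]; [by right|by right|by right|].
have [[y wy]|nw] := pselect (exists y, w (b :: t) y != 0).
  by left; apply: (tree_weight_drop k.+1 _ (wW _)); exact: rep_neq0 wy.
have -> : rep (b :: t) = rep t.
  by apply: xgetPN => y wy; apply: nw; exists y.
exact: IH.
Qed.

(** [h] varies by at most [e] over the points whose random branch can pass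
    through a given node of level [n]. *)
Definition controlled (h : Y -> R) (e : R) (n : nat) :=
  forall s, size s = n -> forall y y', w s y != 0 -> w s y' != 0 ->
    `|h y - h y'| <= e.

Lemma controlledS h e n k : controlled h e n -> controlled h e (n + k).
Proof.
move=> H s sn y y' wy wy'; apply: (H (drop k s)).
- by rewrite size_drop sn addnK.
- exact: (tree_weight_drop k s (wW y)).
- exact: (tree_weight_drop k s (wW y')).
Qed.

Lemma controlled_rep h e n k t : 0 <= e -> controlled h e n ->
  size t = (n + k)%N -> `|h (rep t) - h (rep (drop k t))| <= e.
Proof.
move=> e0 H tn; have [wt|->] := rep_drop k t; last by rewrite subrr normr0.
by apply: H wt (rep_neq0 _ _ wt); rewrite size_drop tn addnK.
Qed.

(* The approximations of the extension [E h] and, below, of the average [T f]. *)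
Let extn (h : Y -> R) n x := tree_avg (u x) (fun s => h (rep s)) n.

Lemma extn_dist h e n k x : 0 <= e -> controlled h e n ->
  `|extn h (n + k) x - extn h n x| <= e.
Proof.
move=> e0 H; rewrite -[leRHS](tree_avg_cst (uW x) e n).
by apply: (tree_avg_dist (uW x)) => t tn; exact: (controlled_rep _ _ n).
Qed.

Lemma extn_continuous h n : continuous (extn h n).
Proof.
apply: (continuous_sum _ _ _ (level n) (fun s x => u x s * h (rep s))) => s x.
apply: cvgM; last exact: cvg_cst.
elim: s => [|b s IH] /=; first exact: cvg_cst.
apply: cvgM => //; have vx : {for x, continuous (v s)}.
  exact (turn_continuous _ _ sch s x).
by case: b; [exact: vx|apply: cvgB; [exact: cvg_cst|exact: vx]].
Qed.

Lemma extension_exists : {E : (Y -> R) -> CK &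
  forall h, Z h -> unif_cvg (extn h) (E h)}.
Proof.
pose P h (F : CK) := Z h -> unif_cvg (extn h) F.
apply: (choice (P := P)) => h; have [Zh|nZh] := pselect (Z h); last by exists 0.
have [|l hl] := unif_cauchy_cvg (g := extn h).
  move=> e e0; have [n H] := mw_control mw Zh e0.
  by exists n => k x; exact: extn_dist (ltW e0) H.
have cl : continuous l by apply: unif_cvg_continuous hl; exact: extn_continuous.
by exists (mkcts cl).
Qed.

(* The default value of [xget] is immaterial, as [node s] is nonempty. *)
Let point s : K := xget (projT1 (cid (node_neq0 _ _ sch [::]))) (node s).

Lemma node_point s : node s (point s).
Proof. by apply: xgetPex; exact (node_neq0 _ _ sch s). Qed.

Let avgn (f : K -> R) n y := tree_avg (w ^~ y) (fun s => f (point s)) n.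

Lemma avgn_space f n : Z (avgn f n).
Proof.
rewrite /avgn /tree_avg; elim: (level n) => [|s r IH].
  under eq_fun do rewrite big_nil; exact (fspace0 sZ).
under eq_fun do rewrite big_cons mulrC.
by apply: (fspaceD sZ) IH; apply: (fspaceZ sZ); exact (mw_space mw s).
Qed.

Lemma averaging_exists : {T : CK -> Y -> R &
  forall f, Z (T f) /\ unif_cvg (avgn f) (T f)}.
Proof.
pose P (f : CK) g := Z g /\ unif_cvg (avgn f) g.
apply: (choice (P := P)) => f; have [|l fl] := unif_cauchy_cvg (g := avgn f); last first.
  by exists l; split=> //; apply: (fspace_lim sZ) fl; exact: avgn_space.
move=> e e0; have e20 : 0 < e / 2 by rewrite divr_gt0.
have [N NP] := oscillation_bound sch f _ cK (@cts_fun _ _ f) e20.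
set B := supnorm f; have B0 : 0 <= B by exact: supnorm_ge0.
pose c := e / 2 / (N%:R * (2 * B) + 1).
have D0 : 0 < N%:R * (2 * B) + 1 by rewrite ltr_wpDl // !mulr_ge0.
have [n wc] := mw_small mw (divr_gt0 e20 D0).
exists n => k y.
(* At the nodes where [f] varies by more than [e / 2], only the bound of [f] is
   available; [c] makes the total weight of these nodes small. *)
pose G s := e / 2 + (2 * B) * (oscillates (node := node) f (e / 2) s)%:R.
apply: (@le_trans _ _ (tree_avg (w ^~ y) G n)).
  apply: (tree_avg_dist (wW y) (fun s => f (point s))) => t tn.
  have nt : node (drop k t) (point t) by apply: (node_drop sch); exact: node_point.
  have nd : node (drop k t) (point (drop k t)) by exact: node_point.
  rewrite /G; have [_|/asboolPn nosc] := boolP (oscillates f (e / 2) (drop k t)).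
    rewrite mulr1 ler_wpDl ?(ltW e20) // mulr_natl mulr2n.
    by rewrite (le_trans (ler_normB _ _)) // lerD ?le_supnorm.
  rewrite mulr0 addr0 leNgt; apply/negP => lt_e.
  by apply: nosc; exists (point t), (point (drop k t)).
rewrite /G tree_avgD tree_avg_cst // tree_avgZ [leRHS]splitr lerD2l.
apply: (@le_trans _ _ (2 * B * (N%:R * c))).
  by rewrite ler_wpM2l ?mulr_ge0 // NP // => s; exact: wc.
rewrite mulrCA mulrA [_ * c]mulrA ler_pdivrMr // [leLHS]mulrC.
by rewrite ler_wpM2l ?(ltW e20) // lerDl.
Qed.

(** [C(K)] contains a complemented copy of [Z]. *)
Lemma averaging_pair : exists (E : (Y -> R) -> CK) (T : CK -> Y -> R),
  [/\ forall g h, Z g -> Z h -> E (fun y => g y + h y) = E g + E h,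
      forall a h, Z h -> E (fun y => a * h y) = a *: E h &
      forall h c, Z h -> (forall y, `|h y| <= c) -> forall x, `|E h x| <= c] /\
  [/\ forall f, Z (T f),
      forall f g y, T (f + g) y = T f y + T g y,
      forall a f y, T (a *: f) y = a * T f y,
      forall f y, `|T f y| <= `|f| &
      forall h, Z h -> T (E h) =1 h].
Proof.
have [E EP] := extension_exists; have [T /all_and2[ZT TP]] := averaging_exists.
exists E, T; split; split.
- move=> g h Zg Zh; apply: Cspace_eqP => x /=.
  apply: (unif_cvg_uniq (m := fun x => E g x + E h x)
    (EP _ (fspaceD sZ Zg Zh))).
  apply: unif_cvg_ext (unif_cvgD (EP _ Zg) (EP _ Zh)) => n z.
  by rewrite /extn tree_avgD.
- move=> a h Zh; apply: Cspace_eqP => x /=.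
  apply: (unif_cvg_uniq (m := fun x => a * E h x) (EP _ (fspaceZ sZ a Zh))).
  by apply: unif_cvg_ext (unif_cvgZ a (EP _ Zh)) => n z; rewrite /extn tree_avgZ.
- move=> h c Zh hc; apply: unif_cvg_bound _ (EP _ Zh) => n x.
  by apply: (norm_tree_avg_le (uW x)) => s _ _; exact: hc.
- exact: ZT.
- move=> f g; apply: (unif_cvg_uniq (m := fun y => T f y + T g y) (TP _)).
  by apply: unif_cvg_ext (unif_cvgD (TP f) (TP g)) => n z; rewrite /avgn -tree_avgD.
- move=> a f; apply: (unif_cvg_uniq (m := fun y => a * T f y) (TP _)).
  by apply: unif_cvg_ext (unif_cvgZ a (TP f)) => n z; rewrite /avgn -tree_avgZ.
- move=> f; apply: unif_cvg_bound _ (TP f) => n y.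
  by apply: (norm_tree_avg_le (wW y)) => s _ _; exact: le_supnorm.
(* Only nodes [s] with [w s y != 0] contribute to the mean [T (E h) y].  For them
   [E h (point s)] is close to [h (rep s)], and [h (rep s)] to [h y]. *)
- move=> h Zh y; apply: eps_eq => e e0.
  have e20 : 0 < e / 2 by rewrite divr_gt0.
  have e40 : 0 < e / 2 / 2 by rewrite divr_gt0.
  have [n hn] := mw_control mw Zh e40.
  have [m Tm] := TP (E h) _ e20.
  apply: (dist_split (c := avgn (E h) (n + m) y)).
    by rewrite distrC Tm // leq_addl.
  apply: tree_avg_dist_cst => // s sn ws.
  have hnm := controlledS _ _ _ m hn.
  apply: (dist_split (c := h (rep s))); last first.
    by apply: (hnm s sn) => //; exact (rep_neq0 _ _ ws).
  apply/ler_addgt0Pr => a a0; have [k Ek] := EP h Zh a a0.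
  have {1}<- : extn h (n + m) (point s) = h (rep s).
    rewrite /extn -sn; exact (tree_avg_node sch (fun s => h (rep s)) s _ (node_point s)).
  apply: le_trans (ler_distD (extn h (n + m + k) (point s)) _ _) _.
  rewrite addrC lerD //; first by rewrite extn_dist // ltW.
  by rewrite distrC Ek // leq_addl.
Qed.

End Averaging.

(** * Null sequences of continuous functions on a metrizable compactum *)

Lemma exists_half_pow_le (R : realType) (e : R) : 0 < e ->
  exists n : nat, (2^-1) ^+ n <= e.
Proof.
move=> e0; have /archi_boundP ne : 0 <= e^-1 by rewrite invr_ge0 ltW.
exists (Num.Def.archi_bound e^-1); set n := Num.Def.archi_bound _ in ne *.
rewrite exprVn invf_ple ?posrE ?exprn_gt0 //; apply: le_trans (ltW ne) _.
by rewrite -natrX ler_nat ltnW // ltn_expl.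
Qed.

(** Functions [c i] in [Z] with values in [0, 1], such that the conditions
    [c i y = 1] and [c i y' <> 0], for suitable [i] in a finite set, force the
    values of a given function of [Z] at [y] and [y'] to be close. *)
Definition separating_functions (R : realType) (Y : Type)
    (Z : (Y -> R) -> Prop) (I : countType) (c : I -> Y -> R) :=
  [/\ forall i, Z (c i), forall i y, 0 <= c i y <= 1 &
      forall h, Z h -> forall e : R, 0 < e -> exists F : seq I, forall y,
        exists i, [/\ i \in F, c i y = 1 &
          forall y', c i y' != 0 -> `|h y - h y'| <= e]].

(** Toss the coins of bias [c i y] one after the other.  A fair coin is tossed
    before each of them, which makes the law of the outcome nonatomic. *)
Lemma milutin_weight_exists (R : realType) (Y : Type) (Z : (Y -> R) -> Prop)
    (I : countType) (c : I -> Y -> R) :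
    function_space R Y Z -> Z (fun=> 1) ->
    (forall g h, Z g -> Z h -> (forall y, 0 <= g y <= 1) ->
       (forall y, 0 <= h y <= 1) -> Z (fun y => g y * h y)) ->
    separating_functions R Y Z I c ->
  exists w, milutin_weight R Y Z w.
Proof.
move=> sZ Z1 ZM [Zc c01 cctl].
pose coin j y := if odd j then
  if unpickle j./2 is Some i then c i y else 2^-1 else 2^-1.
have half01 : 0 <= (2^-1 : R) <= 1.
  by rewrite invr_ge0 ler0n invf_le1 // ler1n.
have coin01 j y : 0 <= coin j y <= 1.
  by rewrite /coin; case: ifP => // _; case: unpickle.
have Zcoin j : Z (coin j).
  have Zh : Z (fun=> 2^-1).
    by have := fspaceZ sZ 2^-1 Z1; under eq_fun do rewrite mulr1.
  rewrite /coin; case: (odd j); last exact: Zh.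
  case: (unpickle j./2) => [i|].
    exact: Zc.
  exact: Zh.
have Zcoin' j : Z (fun y => 1 - coin j y).
  have := fspaceD sZ Z1 (fspaceZ sZ (-1) (Zcoin j)).
  by under eq_fun do rewrite mulN1r.
pose w s y := walk_weight (fun s => coin (size s) y) s.
have wW y : tree_weight (w ^~ y) by apply: walk_weightP => s; exact: coin01.
have w01 s y : 0 <= w s y <= 1.
  rewrite (tree_weight_ge0 (wW y)) /=; elim: s => //= b s IH.
  exact: le_trans (tree_weight_cons (wW y) b s) IH.
exists w; split => //.
- elim => [|b s IH]; first exact: Z1.
  rewrite /w /=; apply: (ZM _ _ IH) => //.
    by case: b; [exact: Zcoin|exact: Zcoin'].
  move=> y; case/andP: (coin01 (size s) y) => p0 p1; case: b; first by rewrite p0.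
  by rewrite subr_ge0 p1 gerBl.
(* Every second turn halves the weight. *)
- move=> e e0; have [n ne] := exists_half_pow_le R e e0.
  have wn s y : w s y <= (2^-1) ^+ uphalf (size s).
    elim: s => [|b s IH]; first by rewrite expr0.
    rewrite -[size (b :: s)]/(size s).+1 uphalf_half /= exprD.
    rewrite -[w (b :: s) y]/(w s y * (if b then _ else _)) mulrC.
    have [w0 w1] := andP (w01 s y).
    apply: ler_pM => //; first by case/andP: (coin01 (size s) y); case: b;
      rewrite ?subr_ge0.
    rewrite /coin; case: odd => /=; last first.
      by rewrite expr1; case: b => //; rewrite lerBlDr -div1r -splitr.
    rewrite expr0; case: unpickle => [i|].
      by case/andP: (c01 i y) => c0 c1; case: b; rewrite // gerBl.
    by case/andP: half01 => h0 h1; case: b; rewrite // gerBl.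
  exists n.*2 => s y sn; apply: le_trans (wn s y) _.
  by rewrite sn uphalf_double.
(* A branch whose turn at the coin [c i] is [true] has weight zero at the points
   where [c i] vanishes; when the turn is [false], at those where [c i] is 1. *)
- move=> h Zh e e0; have [F FP] := cctl h Zh e e0.
  have [n nF] : exists n, forall i, i \in F -> (pickle i < n)%N.
    elim: F {FP} => [|i F [n nP]]; first by exists 0%N.
    exists (maxn (pickle i).+1 n) => j; rewrite inE => /orP[/eqP ->|/nP jn].
      by rewrite leq_maxl.
    by rewrite leq_max jn orbT.
  exists n.*2 => s sn y y' wy wy'; have [i [/nF iF ciy1]] := FP y; apply.
  have coini z : coin (pickle i).*2.+1 z = c i z.
    by rewrite /coin /= odd_double uphalf_double pickleK.
  have lt_in : ((pickle i).*2.+2 <= n.*2)%N by rewrite -doubleS leq_double.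
  have := tree_weight_drop (n.*2 - (pickle i).*2.+2) _ (wW y) wy.
  have := tree_weight_drop (n.*2 - (pickle i).*2.+2) _ (wW y') wy'.
  have : size (drop (n.*2 - (pickle i).*2.+2) s) = (pickle i).*2.+2.
    by rewrite size_drop sn subKn.
  case: (drop _ s) => [//|b r] /= [sr].
  rewrite /w /= sr !coini; case: b; rewrite !mulf_eq0 !negb_or.
    by move=> /andP[].
  by move=> _ /andP[_]; rewrite ciy1 subrr eqxx.
Qed.

Section Sequences.
Context {R : realType} {M : topologicalType}.

(** The sequences of continuous functions on [M] that converge uniformly to a
    constant, which the Cauchy condition leaves unnamed.  For compact [M] they
    are the restrictions to [nat * M] of the continuous functions on its
    one-point compactification, [nat] being discrete. *)
Definition cvg_to_constant (h : nat * M -> R) : Prop :=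
  (forall k, continuous (fun y => h (k, y))) /\
  forall e : R, 0 < e -> exists N, forall k l, (N <= k)%N -> (N <= l)%N ->
    forall y z, `|h (k, y) - h (l, z)| <= e.

Lemma cvg_to_constant_space : function_space R (nat * M)%type cvg_to_constant.
Proof.
split.
- split=> [k y|e e0]; first exact: cvg_cst.
  by exists 0%N => *; rewrite subrr normr0 ltW.
- move=> g h [cg gP] [ch hP]; split=> [k y|e e0].
    by apply: cvgD; [exact: cg|exact: ch].
  have e20 : 0 < e / 2 by rewrite divr_gt0.
  have [N NP] := gP _ e20; have [N' NP'] := hP _ e20.
  exists (maxn N N') => k l; rewrite !geq_max => /andP[? ?] /andP[? ?] y z.
  rewrite opprD addrACA [leRHS]splitr (le_trans (ler_normD _ _)) // lerD //.
    exact: NP.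
  exact: NP'.
- move=> a h [ch hP]; split=> [k y|e e0].
    by apply: cvgM; [exact: cvg_cst|exact: ch].
  have a1 : 0 < `|a| + 1 by rewrite ltr_wpDl.
  have [N NP] := hP _ (divr_gt0 e0 a1); exists N => k l Nk Nl y z.
  rewrite -mulrBr normrM.
  rewrite (le_trans (ler_wpM2l (normr_ge0 a) (NP k l Nk Nl y z))) //.
  by rewrite mulrA ler_pdivrMr // mulrC ler_wpM2l ?(ltW e0) // lerDl.
- move=> g l gP gl; split=> [k|e e0].
    apply: (unif_cvg_continuous _ _ (fun n y => g n (k, y))).
      by move=> n; have [] := gP n.
    by move=> e e0; have [n nP] := gl e e0; exists n => m nm y; exact: nP.
  have e20 : 0 < e / 2 by rewrite divr_gt0.
  have e40 : 0 < e / 2 / 2 by rewrite divr_gt0.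
  have [n /(_ n (leqnn n)) nP] := gl _ e40.
  have [_ /(_ _ e20)[N NP]] := gP n.
  exists N => k k' Nk Nk' y z.
  have -> : l (k, y) - l (k', z) = (g n (k, y) - g n (k', z)) +
      ((l (k, y) - g n (k, y)) + (g n (k', z) - l (k', z))).
    by ring.
  rewrite [leRHS]splitr (le_trans (ler_normD _ _)) // lerD ?NP //.
  rewrite [leRHS]splitr (le_trans (ler_normD _ _)) // lerD ?nP //.
  by rewrite distrC nP.
Qed.

Lemma cvg_to_constantM (g h : nat * M -> R) :
  cvg_to_constant g -> cvg_to_constant h ->
  (forall y, 0 <= g y <= 1) -> (forall y, 0 <= h y <= 1) ->
  cvg_to_constant (fun y => g y * h y).
Proof.
move=> [cg gP] [ch hP] g01 h01; split=> [k y|e e0].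
  by apply: cvgM; [exact: cg|exact: ch].
have e20 : 0 < e / 2 by rewrite divr_gt0.
have [N NP] := gP _ e20; have [N' NP'] := hP _ e20.
exists (maxn N N') => k l; rewrite !geq_max => /andP[? ?] /andP[? ?] y z.
have -> : g (k, y) * h (k, y) - g (l, z) * h (l, z) =
    g (k, y) * (h (k, y) - h (l, z)) + (g (k, y) - g (l, z)) * h (l, z).
  by rewrite mulrBr mulrBl addrA subrK.
rewrite [leRHS]splitr (le_trans (ler_normD _ _)) // lerD //.
  rewrite normrM -[leRHS]mul1r ler_pM //; last exact: NP'.
  by case/andP: (g01 (k, y)) => g0 g1; rewrite ger0_norm.
rewrite normrM -[leRHS]mulr1 ler_pM //; first exact: NP.
by case/andP: (h01 (l, z)) => h0 h1; rewrite ger0_norm.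
Qed.

(** For each [n], finitely many balls of radius [1 / (n + 1)] cover [M].  The
    function [c (n, i)] is 1 on the ball of that radius around the [i]-th of
    their centers and 0 outside the ball of twice that radius. *)
Lemma metrizable_separating : compact [set: M] -> metrizable R M ->
  exists c : nat * nat -> M -> R,
    separating_functions R M (fun h => continuous h) _ c.
Proof.
move=> cM [dist [dist0 distE distC distT] nbhsM].
have ball_nbhs y e : 0 < e -> nbhs y [set z | dist y z < e].
  by move=> e0; rewrite nbhsM; exists e.
have dist_lip x y z : `|dist x y - dist x z| <= dist y z.
  have xzy := distT x z y; have xyz := distT x y z; rewrite (distC z y) in xzy.
  by rewrite ler_norml; apply/andP; split; lra.
have n1 n : 0 < n.+1%:R :> R by rewrite ltr0n.
have /choice[C CP] : forall n : nat, exists s : seq M,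
    forall y, exists2 x, x \in s & dist x y < n.+1%:R^-1.
  move=> n; apply: (compact_finite_cover _ cM
    (fun x => [set y | dist x y < n.+1%:R^-1])) => x.
  by apply: ball_nbhs; rewrite invr_gt0.
have [[m0 _]|M0] := pselect ([set: M] !=set0); last first.
  exists (fun _ _ => 0); split.
  - by move=> i y; exact: cvg_cst.
  - by move=> i y; rewrite lexx ler01.
  - by move=> h _ e _; exists [::] => y; case: M0; exists y.
pose f (i : nat * nat) y : R := 2 - i.1.+1%:R * dist (nth m0 (C i.1) i.2) y.
pose c i y : R := Num.max 0 (Num.min 1 (f i y)).
exists c; split.
- move=> i; have cf : continuous (f i).
    move=> y; apply: cvgB; first exact: cvg_cst.
    apply: cvgM; first exact: cvg_cst.
    apply/cvgrPdist_le => e e0; have := ball_nbhs y e e0.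
    apply: filterS => z /= yz; apply: le_trans (ltW yz).
    exact: dist_lip.
  apply: (@max_fun_continuous _ M R (fun=> 0) (fun y => Num.min 1 (f i y))).
    by move=> y; exact: cvg_cst.
  apply: (@min_fun_continuous _ M R (fun=> 1) (f i)) => // y; exact: cvg_cst.
- by move=> i y; rewrite /c le_max lexx /= ge_max ler01 ge_min lexx.
- move=> h ch e e0.
  have e20 : 0 < e / 2 by rewrite divr_gt0.
  (* The constant 4 makes room for [y], a center [p] near [y], and [y'] within
     twice the radius of [p]: the radii 1 + 1 + 2 add up along the way from [x]. *)
  have /choice[N NP] : forall x, exists n : nat, forall z,
      dist x z < 4 / n.+1%:R -> `|h x - h z| <= e / 2.
    move=> x; have /cvgrPdist_le/(_ (e / 2) e20) := ch x.
    rewrite nbhsM => -[r /= r0 rP].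
    have /archi_boundP rn : 0 <= 4 / r by rewrite divr_ge0 // ltW.
    exists (Num.Def.archi_bound (4 / r)) => z xz; apply: rP => /=.
    apply: lt_trans xz _; rewrite ltr_pdivrMr // mulrC -ltr_pdivrMr //.
    by rewrite (lt_trans rn) // ltr_nat.
  have [s sP] : exists s : seq M, forall y,
      exists2 x, x \in s & dist x y < (N x).+1%:R^-1.
    apply: (compact_finite_cover _ cM
      (fun x => [set y | dist x y < (N x).+1%:R^-1])) => x.
    by apply: ball_nbhs; rewrite invr_gt0.
  have [n nP] : exists n, forall x, x \in s -> (N x <= n)%N.
    elim: s {sP} => [|x s [n nP]]; first by exists 0%N.
    exists (maxn (N x) n) => z; rewrite inE => /orP[/eqP ->|/nP zn].
      by rewrite leq_maxl.
    by rewrite leq_max zn orbT.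
  exists [seq (n, i) | i <- iota 0 (size (C n))] => y.
  have [p pC py] := CP n y; exists (n, index p (C n)).
  have fE z : f (n, index p (C n)) z = 2 - n.+1%:R * dist p z.
    by rewrite /f /= nth_index.
  split.
  - by apply/mapP; exists (index p (C n)); rewrite // mem_iota index_mem.
  - have : n.+1%:R * dist p y < 1 by rewrite mulrC -ltr_pdivlMr // div1r.
    move=> npy; rewrite /c fE min_l; first by rewrite max_r.
    by lra.
  - move=> y' cy'; have {cy'} py' : dist p y' < 2 * n.+1%:R^-1.
      rewrite ltr_pdivlMr // mulrC ltNge; apply: contra cy' => py'.
      have f0 : f (n, index p (C n)) y' <= 0 by rewrite fE; lra.
      by rewrite /c max_l // ge_min f0 orbT.
    have [x xs xy] := sP y.
    have nx : n.+1%:R^-1 <= (N x).+1%:R^-1 :> R.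
      by rewrite lef_pV2 ?posrE // ler_nat ltnS nP.
    have Nx0 : 0 < (N x).+1%:R^-1 :> R by rewrite invr_gt0.
    have xy' := distT x y y'; have yy' := distT y p y'; rewrite (distC y p) in yy'.
    have := NP x; set a := (N x).+1%:R^-1 in xy nx Nx0 *.
    set b := n.+1%:R^-1 in py py' nx => NPx.
    by apply: (dist_split (c := h x)); [rewrite distrC|]; apply: NPx; lra.
Qed.

Lemma sequences_milutin_weight : compact [set: M] -> metrizable R M ->
  exists w, milutin_weight R (nat * M)%type cvg_to_constant w.
Proof.
move=> cM mM; have [c [cc c01 cctl]] := metrizable_separating cM mM.
(* [(l, None)] stands for the tail of index [l], and [(l, Some j)] for the
   function [c j] on the copy of [M] of index [l]. *)
pose b (i : nat * option (nat * nat)) (y : nat * M) : R :=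
  if i.2 is Some j then (i.1 == y.1)%:R * c j y.2 else (i.1 <= y.1)%N%:R.
apply: (milutin_weight_exists _ _ _ _ b cvg_to_constant_space).
- split=> [k y|e e0]; first exact: cvg_cst.
  by exists 0%N => *; rewrite subrr normr0 ltW.
- exact: cvg_to_constantM.
split.
- move=> [l [j|]]; split=> [k y|e e0].
  + by apply: cvgM; [exact: cvg_cst|exact: cc].
  + exists l.+1 => k k' lk lk' y z; rewrite /b /= !ltn_eqF // !mul0r subrr normr0.
    exact: ltW.
  + exact: cvg_cst.
  + by exists l => k k' lk lk' y z; rewrite /b /= lk lk' subrr normr0 ltW.
- move=> [l [j|]] [k y]; rewrite /b /=; last by case: leq; rewrite ?lexx ?ler01.
  by case: eqP => _; rewrite ?mul1r ?mul0r // lexx ler01.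
- move=> h [ch hP] e e0; have [N NP] := hP e e0.
  have /choice[F FP] := fun k => cctl _ (ch k) e e0.
  exists ((N, None) :: [seq (k, Some j) | k <- iota 0 N, j <- F k]) => -[k y].
  have [Nk|kN] := leqP N k.
    exists (N, None); split; first exact: mem_head.
      by rewrite /b /= Nk.
    move=> [k' y']; rewrite /b /=; have [Nk'|_] := leqP N k'; last by rewrite eqxx.
    by move=> _; exact: NP.
  have [j [jF cj1 jP]] := FP k y; exists (k, Some j); split.
  - rewrite inE; apply/orP; right; apply/allpairsPdep.
    by exists k, j; rewrite mem_iota.
  - by rewrite /b /= eqxx mul1r.
  - move=> [k' y']; rewrite /b /=; have [<-|_] := eqVneq k k'; last first.
      by rewrite mul0r eqxx.
    by rewrite mul1r; exact: jP.
Qed.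

End Sequences.

(** * The isomorphism *)

Section Isomorphism.
Context {R : realType} {d : Order.disp_t} {K : orderTopologicalType d}.
Context (cK : compact [set: K]) {M : topologicalType} (cM : compact [set: M]).
Local Notation CK := (Cspace R cK).
Local Notation CM := (Cspace R cM).
Implicit Types (h : nat * M -> R) (f g : CK) (c : CM).

Definition seq_tail h (y : nat * M) : R := h (y.1.+1, y.2).

Definition seq_cons c h (y : nat * M) : R :=
  if y.1 is k.+1 then h (k, y.2) else c y.2.

Lemma seq_tail_cvg h : cvg_to_constant h -> cvg_to_constant (seq_tail h).
Proof.
move=> [ch hP]; split=> [k|e e0]; first exact: (ch k.+1).
have [N NP] := hP e e0; exists N => k l Nk Nl y z.
by apply: NP; rewrite leqW.
Qed.

Lemma seq_cons_cvg c h : cvg_to_constant h -> cvg_to_constant (seq_cons c h).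
Proof.
move=> [ch hP]; split=> [[|k]|e e0]; [exact: cts_fun|exact: (ch k)|].
have [N NP] := hP e e0; exists N.+1 => -[//|k] [//|l] Nk Nl y z.
exact: NP.
Qed.

(** [E] and [T] embed the space of sequences as a complemented subspace of
    [C(K)]; shifting the sequences there makes room for [C(M)]. *)
Lemma isomorphic_of_averaging (E : (nat * M -> R) -> CK)
    (T : CK -> nat * M -> R) :
    (forall h h', cvg_to_constant h -> cvg_to_constant h' ->
       E (fun y => h y + h' y) = E h + E h') ->
    (forall a h, cvg_to_constant h -> E (fun y => a * h y) = a *: E h) ->
    (forall h r, cvg_to_constant h -> (forall y, `|h y| <= r) ->
       forall x, `|E h x| <= r) ->
    (forall f, cvg_to_constant (T f)) ->
    (forall f g y, T (f + g) y = T f y + T g y) ->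
    (forall a f y, T (a *: f) y = a * T f y) ->
    (forall f y, `|T f y| <= `|f|) ->
    (forall h, cvg_to_constant h -> T (E h) =1 h) ->
  isomorphic CK (CK * CM)%type.
Proof.
move=> ED EZ Eb TC TD TZ Tb TE.
have /choice[H HE] : forall f, exists c : CM, forall y, c y = T f (0%N, y).
  by move=> f; have [cT _] := TC f; exists (mkcts (cT 0%N)).
pose phi1 f := f + (E (seq_tail (T f)) - E (T f)).
pose phi f : CK * CM := (phi1 f, H f).
(* The inverse of [phi] puts [v.2] back at the head of the sequence. *)
pose psi (v : CK * CM) := v.1 + (E (seq_cons v.2 (T v.1)) - E (T v.1)).
have TB f g y : T (f - g) y = T f y - T g y.
  by rewrite -scaleN1r TD TZ mulN1r.
have Tphi f : T (phi1 f) = seq_tail (T f).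
  apply/funext => y; rewrite TD TB (TE (seq_tail _)); last exact: seq_tail_cvg.
  by rewrite TE // addrC subrK.
have Tpsi v : T (psi v) = seq_cons v.2 (T v.1).
  apply/funext => y; rewrite TD TB (TE (seq_cons _ _)); last exact: seq_cons_cvg.
  by rewrite TE // addrC subrK.
have phiK : cancel phi psi.
  move=> f; rewrite /psi /= Tphi.
  have -> : seq_cons (H f) (seq_tail (T f)) = T f.
    by apply/funext => -[[|k] y] //; rewrite /seq_cons /= HE.
  by rewrite /phi1 -[E (T f) - _]opprB addrK.
have psiK : cancel psi phi.
  move=> [g c]; rewrite /phi; congr pair.
    rewrite /phi1 Tpsi /=.
    have -> : seq_tail (seq_cons c (T g)) = T g by apply/funext => -[k y].
    by rewrite /psi /= -[E (T g) - _]opprB addrK.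
  by apply: Cspace_eqP => y; rewrite HE Tpsi.
have lin_phi (a : R) f g : phi (a *: f + g) = a *: phi f + phi g.
  have TL y : T (a *: f + g) y = a * T f y + T g y by rewrite TD TZ.
  have Cf := TC f; have Cg := TC g.
  have sp := @cvg_to_constant_space R M.
  have EL (h h' : nat * M -> R) : cvg_to_constant h -> cvg_to_constant h' ->
      E (fun y => a * h y + h' y) = a *: E h + E h'.
    by move=> Ch Ch'; rewrite ED ?EZ //; exact (fspaceZ sp a Ch).
  rewrite /phi -[RHS]/(a *: phi1 f + phi1 g, a *: H f + H g).
  congr pair; last first.
    by apply: Cspace_eqP => y; rewrite HE TL -!HE.
 
  rewrite /phi1.
  have -> : T (a *: f + g) = (fun y => a * T f y + T g y) by apply/funext.
  rewrite -[seq_tail _]/(fun y => a * seq_tail (T f) y + seq_tail (T g) y).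
  rewrite !EL //; [|exact: seq_tail_cvg|exact: seq_tail_cvg].
  rewrite scalerDr scalerBr [RHS]addrACA; congr (_ + _).
  by rewrite opprD addrACA.
pose L : {linear CK -> (CK * CM)%type} :=
  HB.pack phi (GRing.isLinear.Build R CK (CK * CM)%type *:%R phi lin_phi).
have Eb' h r : 0 <= r -> cvg_to_constant h -> (forall y, `|h y| <= r) ->
    `|E h| <= r.
  by move=> r0 Ch hr; apply: supnorm_le => // x; exact: Eb.
have normDB (V : normedModType R) (x y z : V) (b : R) :
    `|x| <= b -> `|y| <= b -> `|z| <= b -> `|x + (y - z)| <= 3 * b.
  move=> xb yb zb; apply: le_trans (ler_normD _ _) _.
  by have := ler_normB y z; lra.
have ETb f : `|E (T f)| <= `|f| by apply: Eb' => //.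
exists L, psi; split => //.
- exists 3 => f; rewrite prod_normE /= ge_max; apply/andP; split.
    apply: normDB => //; apply: Eb' => //; first exact: seq_tail_cvg.
    by move=> y; exact: Tb.
  apply: (@le_trans _ _ `|f|); last by have := normr_ge0 f; lra.
  by apply: supnorm_le => // y; rewrite HE.
- exists 3 => -[g c]; rewrite /psi /=.
  have gb : `|g| <= `|(g, c)| by rewrite prod_normE /= le_max lexx.
  have cb : `|c| <= `|(g, c)| by rewrite prod_normE /= le_max lexx orbT.
  apply: normDB => //; last exact: le_trans (ETb g) gb.
  apply: Eb' => //; first exact: seq_cons_cvg.
  move=> [[|k] y]; rewrite /seq_cons /=.
    exact: le_trans (le_supnorm c y) cb.
  exact: le_trans (Tb _ _) gb.
Qed.

End Isomorphism.

Theorem lemma5p4 (R : realType) (d : Order.disp_t) (K : orderTopologicalType d)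
    (cK : compact [set: K]) (sK : separable_space K) (uK : ~ countable [set: K])
    (M : topologicalType) (cM : compact [set: M]) (mM : metrizable R M)
    (neM : [set: M] !=set0) :
  isomorphic (Cspace R cK) (Cspace R cK * Cspace R cM)%type.
Proof.
have [node [v sch]] := @cantor_scheme_exists R d K cK sK uK.
have [w mw] := sequences_milutin_weight cM mM.
have [m0 _] := neM.
have [E [T [[ED EZ Eb] [TC TD TZ Tb TE]]]] :=
  averaging_pair cK sch (0%N, m0) cvg_to_constant_space mw.
exact: (isomorphic_of_averaging cK cM E T).
Qed.
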